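(* Let $G$ be a finite abelian group presented as $G=G_1\times\cdots\times G_k$, where each $G_i$ is a cyclic group of order $n_i$. Let $A$ be any abelian group, regarded as a $G$-module with the trivial action. Then $$H^{2}(G,A)\cong \left(\bigoplus_{i=1}^{k}\frac{A}{n_iA}\right)\oplus\left(\bigoplus_{1\le i<j\le k}\mathrm{Ann}_A(n_i)\cap \mathrm{Ann}_A(n_j)\right).$$
   Context: $H^\bullet(G,A)=\mathrm{Ext}^\bullet_{\mathbb{Z}[G]}(\mathbb{Z},A)$ denotes group cohomology, where $\mathbb{Z}$ carries the trivial action. The abelian group $A$ is written additively as a $\mathbb{Z}$-module: for a positive integer $n$, $nA=\{na : a\in A\}$ and $\mathrm{Ann}_A(n)=\{a\in A : na=0\}$. *)

(* Defs.v *)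
From HB Require Import structures.
From mathcomp Require Import all_boot all_order all_fingroup all_algebra all_solvable.
From mathcomp Require Import boolp.
From mathcomp Require freeg.

Set Implicit Arguments.
Unset Strict Implicit.
Unset Printing Implicit Defensive.

Import GRing.Theory.
Local Open Scope ring_scope.
Local Open Scope quotient_scope.

Definition zmod_isomorphic (U V : zmodType) : Prop :=
  exists f : {additive U -> V}, bijective f.

Definition subzmod (V : zmodType) (S : zmodClosed V) : Type :=
  {x : V | x \in S}.

Section SubZmod.
Variables (V : zmodType) (S : zmodClosed V).
HB.instance Definition _ := SubChoice.on (subzmod S).
HB.instance Definition _ := [SubChoice_isSubZmodule of subzmod S by <:].
End SubZmod.

Notation quotzmod S := (Quotient.quot S).

Definition zmodI (V : zmodType) (S T : zmodClosed V) : {pred V} :=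
  [predI S & T].

Fact zmodI_closed (V : zmodType) (S T : zmodClosed V) : zmod_closed (zmodI S T).
Proof.
split=> [|x y]; first by rewrite !inE !rpred0.
by rewrite !inE => /andP[xS xT] /andP[yS yT]; rewrite !rpredB.
Qed.
HB.instance Definition _ (V : zmodType) (S T : zmodClosed V) :=
  GRing.isZmodClosed.Build V (zmodI S T) (zmodI_closed S T).

Definition multiples (A : zmodType) (n : nat) : {pred A} :=
  [pred x | `[< exists a, x = a *+ n >]].
Arguments multiples : clear implicits.

Fact multiples_closed (A : zmodType) n : zmod_closed (multiples A n).
Proof.
split=> [|x y]; first by apply/asboolP; exists 0; rewrite mul0rn.
move=> /asboolP[a ->] /asboolP[b ->].
by apply/asboolP; exists (a - b); rewrite mulrnBl.
Qed.
HB.instance Definition _ (A : zmodType) n :=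
  GRing.isZmodClosed.Build A (multiples A n) (@multiples_closed A n).

Definition Ann (A : zmodType) (n : nat) : {pred A} := [pred a | a *+ n == 0].
Arguments Ann : clear implicits.

Fact Ann_closed (A : zmodType) n : zmod_closed (Ann A n).
Proof.
split=> [|x y]; rewrite !inE ?mul0rn // mulrnBl => /eqP-> /eqP->.
by rewrite subrr.
Qed.
HB.instance Definition _ (A : zmodType) n :=
  GRing.isZmodClosed.Build A (Ann A n) (@Ann_closed A n).

(* Over a finite index type the direct sum is the product. *)
Definition dirsum (I : finType) (V : I -> zmodType) : Type :=
  {dffun forall i, V i}.

Section DirSum.
Variables (I : finType) (V : I -> zmodType).
Implicit Types x y : {dffun forall i, V i}.

HB.instance Definition _ := Choice.on (dirsum V).

Let zero : {dffun forall i, V i} := [ffun i => 0].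
Let opp x : {dffun forall i, V i} := [ffun i => - x i].
Let add x y : {dffun forall i, V i} := [ffun i => x i + y i].

Fact dirsum_addA : associative add.
Proof. by move=> x y z; apply/ffunP => i; rewrite !ffunE addrA. Qed.
Fact dirsum_addC : commutative add.
Proof. by move=> x y; apply/ffunP => i; rewrite !ffunE addrC. Qed.
Fact dirsum_add0 : left_id zero add.
Proof. by move=> x; apply/ffunP => i; rewrite !ffunE add0r. Qed.
Fact dirsum_addN : left_inverse zero opp add.
Proof. by move=> x; apply/ffunP => i; rewrite !ffunE addNr. Qed.

HB.instance Definition _ := GRing.isZmodule.Build (dirsum V)
  dirsum_addA dirsum_addC dirsum_add0 dirsum_addN.
End DirSum.

Section LinearZmod.
Variables (R : nzRingType) (U V : lmodType R).
Implicit Types f g : {linear U -> V}.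

Lemma linear_ext f g : f =1 g -> f = g.
Proof.
case: f => f [mf sf]; case: g => g [mg sg] /= /funext fg.
move: mf sf mg sg; rewrite fg => mf sf mg sg.
congr GRing.Linear.Pack; congr GRing.Linear.Class.
  by case: mf => mf; case: mg => mg; rewrite (Prop_irrelevance mf mg).
by case: sf => sf; case: sg => sg; rewrite (Prop_irrelevance sf sg).
Qed.

HB.instance Definition _ := gen_eqMixin {linear U -> V}.
HB.instance Definition _ := gen_choiceMixin {linear U -> V}.

Let zero : {linear U -> V} := \0.
Let opp f : {linear U -> V} := \- f.
Let add f g : {linear U -> V} := f \+ g.

Fact linear_addA : associative add.
Proof. by move=> f g h; apply: linear_ext => x /=; rewrite addrA. Qed.
Fact linear_addC : commutative add.
Proof. by move=> f g; apply: linear_ext => x /=; rewrite addrC. Qed.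
Fact linear_add0 : left_id zero add.
Proof. by move=> f; apply: linear_ext => x /=; rewrite add0r. Qed.
Fact linear_addN : left_inverse zero opp add.
Proof. by move=> f; apply: linear_ext => x /=; rewrite addNr. Qed.

HB.instance Definition _ := GRing.isZmodule.Build {linear U -> V}
  linear_addA linear_addC linear_add0 linear_addN.
End LinearZmod.

Definition projective (R : nzRingType) (P : lmodType R) : Prop :=
  forall (X Y : lmodType R) (g : {linear X -> Y}) (f : {linear P -> Y}),
    (forall y, exists x, g x = y) ->
    exists h : {linear P -> X}, forall p, g (h p) = f p.

Record projective_resolution (R : nzRingType) (M : lmodType R) := {
  res_mod :> nat -> lmodType R;
  res_diff : forall n, {linear res_mod n.+1 -> res_mod n};
  res_aug : {linear res_mod 0 -> M};
  res_projective : forall n, projective (res_mod n);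
  res_aug_surj : forall m, exists x, res_aug x = m;
  res_exact0 : forall x, res_aug x = 0 <-> exists y, res_diff 0 y = x;
  res_exactS : forall n x,
    res_diff n x = 0 <-> exists y, res_diff n.+1 y = x
}.

Section Ext.
Variables (R : nzRingType) (M : lmodType R) (P : projective_resolution M).
Variables (n : nat) (N : lmodType R).

Definition codiff m (f : {linear P m -> N}) : {linear P m.+1 -> N} :=
  f \o res_diff P m.

Definition cocycles : {pred {linear P n -> N}} := [pred f | codiff f == 0].

Fact cocycles_closed : zmod_closed cocycles.
Proof.
split=> [|f g]; rewrite !inE; first by apply/eqP/linear_ext.
move=> /eqP f0 /eqP g0; apply/eqP/linear_ext => x.
have := congr1 (fun h : {linear _ -> _} => h x) f0.
have /= := congr1 (fun h : {linear _ -> _} => h x) g0.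
by move=> -> ->; rewrite subrr.
Qed.
HB.instance Definition _ :=
  GRing.isZmodClosed.Build {linear P n -> N} cocycles cocycles_closed.

Definition is_coboundary m : {linear P m -> N} -> Prop :=
  match m with
  | 0 => fun f => f = 0
  | m'.+1 => fun f => exists g : {linear P m' -> N}, f = codiff g
  end.

Fact is_coboundary0 m : @is_coboundary m 0.
Proof. by case: m => //= m; exists 0; apply: linear_ext. Qed.

Fact is_coboundaryB m (f g : {linear P m -> N}) :
  is_coboundary f -> is_coboundary g -> is_coboundary (f - g).
Proof.
case: m f g => [|m] /= f g; first by move=> -> ->; rewrite subrr.
by move=> [u ->] [v ->]; exists (u - v); apply: linear_ext.
Qed.

Definition coboundaries : {pred subzmod cocycles} :=
  [pred z | `[< is_coboundary (val z) >]].

Fact coboundaries_closed : zmod_closed coboundaries.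
Proof.
split=> [|f g]; first by apply/asboolP; rewrite raddf0; exact: is_coboundary0.
by move=> /asboolP f0 /asboolP g0; apply/asboolP; rewrite raddfB; exact: is_coboundaryB.
Qed.
HB.instance Definition _ :=
  GRing.isZmodClosed.Build (subzmod cocycles) coboundaries coboundaries_closed.

(* Ext^n_R(M, N), computed as the n-th cohomology group of the complex
   Hom_R(P, N), for P a projective resolution of M.  Resolutions exist by
   projective_resolution_exists below. *)
Definition Ext : zmodType := quotzmod coboundaries.
End Ext.

Section ResolutionExists.
Import freeg.
Variable R : nzRingType.

Section FreeCover.
Variable M : lmodType R.
Local Notation F := {freeg M / R}.

Section Lift.
Variables (X : lmodType R) (h : M -> X).

Fact fglift_sum (D : F) : fglift h D = \sum_(x <- dom D) coeff x D *: h x.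
Proof.
rewrite -{1}(freeg_sumE D).
rewrite (big_morph (fglift h) (id1 := 0) (op1 := +%R)).
- by apply: eq_bigr => x _; rewrite liftU.
- move=> x y; have := lift_is_additive h.
  move=> ad; have := ad (x + y) y; rewrite addrK => ->; by rewrite subrK.
- by have := lift_is_additive h 0 0; rewrite !subrr.
Qed.

Fact fglift_is_linear : linear (fglift h).
Proof.
have ad := lift_is_additive h.
have ad0 : fglift h 0 = 0 by have := ad 0 0; rewrite !subrr.
have adD x y : fglift h (x + y) = fglift h x + fglift h y.
  by have := ad (x + y) y; rewrite addrK => ->; rewrite subrK.
move=> c x y; rewrite adD; congr (_ + _).
rewrite [c *: x]/GRing.scale /= /fgscale (big_morph _ adD ad0) fglift_sum.
by rewrite scaler_sumr; apply: eq_bigr => z _; rewrite liftU scalerA.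
Qed.
HB.instance Definition _ := GRing.isLinear.Build R F X _ (fglift h)
  fglift_is_linear.
End Lift.

Fact free_projective : projective F.
Proof.
move=> X Y g f gS.
have /choice[h hP] : forall m : M, exists x, g x = f << m >> by move=> m; apply: gS.
exists (fglift h : {linear F -> X}) => D /=.
rewrite fglift_sum -[in RHS](freeg_sumE D) !linear_sum.
apply: eq_bigr => m _; rewrite linearZ /= hP -linearZ; congr (f _).
by apply/eqP/freeg_eqP => x; rewrite coeffZ !coeffU mulrA mulr1.
Qed.

Definition free_cover : {linear F -> M} := fglift id.

Fact free_cover_surj m : exists D, free_cover D = m.
Proof. by exists << m >>; rewrite /free_cover /= liftU scale1r. Qed.

Definition syzygy_pred : {pred F} := [pred D | free_cover D == 0].

Fact syzygy_closed : submod_closed syzygy_pred.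
Proof.
split=> [|c x y]; rewrite !inE ?raddf0 //.
by move=> /eqP x0 /eqP y0; rewrite linearP x0 y0 scaler0 addr0.
Qed.
HB.instance Definition _ := GRing.isSubmodClosed.Build R F syzygy_pred
  syzygy_closed.

Definition syzygy : Type := {D : F | D \in syzygy_pred}.
HB.instance Definition _ := SubChoice.on syzygy.
HB.instance Definition _ := [SubChoice_isSubLmodule of syzygy by <:].
End FreeCover.

Fixpoint syzygies (M : lmodType R) n : lmodType R :=
  if n is m.+1 then syzygy (syzygies M m) else M.

Theorem projective_resolution_exists (M : lmodType R) :
  inhabited (projective_resolution M).
Proof.
pose S := syzygies M.
pose d n : {linear {freeg (S n.+1) / R} -> {freeg (S n) / R}} :=
  (val : {linear syzygy (S n) -> _}) \o free_cover (S n.+1).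
have ex n x : free_cover (S n) x = 0 <-> exists y, d n y = x.
  split=> [x0|[y <-]]; last by rewrite /d /=; exact: (eqP (valP (free_cover (S n.+1) y))).
  have xS : x \in @syzygy_pred (S n) by apply/eqP.
  by have [y yE] := @free_cover_surj (S n.+1) (Sub x xS); exists y; rewrite /d /= yE.
split; refine (@Build_projective_resolution R M
  (fun n => {freeg (S n) / R} : lmodType R) d (free_cover M) _ _ (ex 0) _).
- by move=> n; exact: free_projective.
- exact: free_cover_surj.
move=> n x; rewrite -ex /d /=.
have v0 : val (0 : syzygy (S n)) = 0 by exact: raddf0.
by split=> [vx|->//]; apply: val_inj; rewrite v0 -vx.
Qed.
End ResolutionExists.

(* The integral group ring Z[G] of a finite group: x : group_ring G stands for
   \sum_g x(g) g, with convolution product. *)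
Definition group_ring (G : finGroupType) : Type := {ffun G -> int}.

Section GroupRing.
Variable G : finGroupType.
Implicit Types x y z : group_ring G.

HB.instance Definition _ := GRing.Zmodule.on (group_ring G).

Definition gr_one : group_ring G := [ffun g => (g == 1%g)%:R].
Definition gr_mul x y : group_ring G :=
  [ffun g => \sum_h x h * y (h^-1 * g)%g].

Fact gr_mulA : associative gr_mul.
Proof.
move=> x y z; apply/ffunP => g; rewrite !ffunE.
under eq_bigr => h _ do rewrite ffunE mulr_sumr.
under [RHS]eq_bigr => h _ do rewrite ffunE mulr_suml.
rewrite [RHS]exchange_big /=; apply: eq_bigr => h _.
rewrite [RHS](reindex_inj (mulgI h)) /=; apply: eq_bigr => l _.
by rewrite mulrA mulKg invMg mulgA.
Qed.
Fact gr_mul1 : left_id gr_one gr_mul.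
Proof.
move=> x; apply/ffunP => g; rewrite !ffunE (bigD1 1%g) //= ffunE eqxx mul1r.
rewrite invg1 mul1g big1 ?addr0 // => h h1.
by rewrite ffunE (negbTE h1) mul0r.
Qed.
Fact gr_1mul : right_id gr_one gr_mul.
Proof.
move=> x; apply/ffunP => g; rewrite !ffunE (bigD1 g) //= ffunE mulVg eqxx mulr1.
rewrite big1 ?addr0 // => h hg.
by rewrite ffunE -eq_mulVg1 (negbTE hg) mulr0.
Qed.
Fact gr_mulDl : left_distributive gr_mul +%R.
Proof.
move=> x y z; apply/ffunP => g; rewrite !ffunE -big_split /=.
by apply: eq_bigr => h _; rewrite ffunE mulrDl.
Qed.
Fact gr_mulDr : right_distributive gr_mul +%R.
Proof.
move=> x y z; apply/ffunP => g; rewrite !ffunE -big_split /=.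
by apply: eq_bigr => h _; rewrite ffunE mulrDr.
Qed.
Fact gr_one_neq0 : gr_one != 0.
Proof. by apply/eqP => /ffunP/(_ 1%g); rewrite !ffunE eqxx. Qed.

HB.instance Definition _ := GRing.Zmodule_isNzRing.Build (group_ring G)
  gr_mulA gr_mul1 gr_1mul gr_mulDl gr_mulDr gr_one_neq0.

Definition augmentation x : int := \sum_g x g.

Fact augmentation1 : augmentation 1 = 1.
Proof.
rewrite /augmentation (bigD1 1%g) //= ffunE eqxx big1 ?addr0 // => g g1.
by rewrite ffunE (negbTE g1).
Qed.
Fact augmentationD x y : augmentation (x + y) = augmentation x + augmentation y.
Proof. by rewrite -big_split; apply: eq_bigr => g _; rewrite ffunE. Qed.
Fact augmentationM x y : augmentation (x * y) = augmentation x * augmentation y.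
Proof.
rewrite /augmentation mulr_suml; under eq_bigr => g _ do rewrite ffunE.
rewrite exchange_big /=; apply: eq_bigr => h _; rewrite mulr_sumr.
by rewrite (reindex_inj (mulgI h)); apply: eq_bigr => l _; rewrite mulKg.
Qed.
End GroupRing.

(* The abelian group A on which every g in G acts as the identity. *)
Definition trivial_module (G : finGroupType) (A : zmodType) : Type := A.

Section TrivialModule.
Variables (G : finGroupType) (A : zmodType).
HB.instance Definition _ := GRing.Zmodule.on (trivial_module G A).

Let scale (x : group_ring G) (a : trivial_module G A) : trivial_module G A :=
  a *~ augmentation x.

Fact triv_scaleA x y a : scale x (scale y a) = scale (x * y) a.
Proof. by rewrite /scale augmentationM mulrzA mulrzAC. Qed.
Fact triv_scale1 : left_id 1 scale.
Proof. by move=> a; rewrite /scale augmentation1 mulr1z. Qed.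
Fact triv_scaleDr : right_distributive scale +%R.
Proof. by move=> x a b; rewrite /scale mulrzDl. Qed.
Fact triv_scaleDl a : {morph scale^~ a : x y / x + y}.
Proof. by move=> x y; rewrite /scale augmentationD mulrzDr. Qed.

HB.instance Definition _ := GRing.Zmodule_isLmodule.Build (group_ring G)
  (trivial_module G A) triv_scaleA triv_scale1 triv_scaleDr triv_scaleDl.
End TrivialModule.

Definition group_cohomology (G : finGroupType)
    (P : projective_resolution (trivial_module G int))
    (n : nat) (A : lmodType (group_ring G)) : zmodType :=
  Ext P n A.

(* Main.v *)
From HB Require Import structures.
Require Import Defs.
From mathcomp Require Import all_boot all_order all_fingroup all_algebra all_solvable.
From mathcomp Require Import boolp.

(** The second cohomology is computed by inhomogeneous 2-cocycles, and a
    2-cocycle c on a finite abelian group with trivial coefficients is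
    determined up to coboundary by two families of elements of A: with s_i a
    generator of the i-th cyclic factor,
      - the power invariants, the sum of c(s_i^m, s_i) over 0 <= m < n_i,
      - the commutator invariants c(s_i, s_j) - c(s_j, s_i).
    If E is the extension of G by A with factor set c, these measure
    respectively the n_i-th power of a lift of s_i to E, and the commutator of
    lifts of s_i and s_j.

    Replacing c by c + dw adds n_i w(s_i) to the i-th power invariant
    ([power_invariant_cobound]) and leaves the commutator invariants unchanged.
    The commutator c(g,h) - c(h,g) is bimultiplicative, so its values on
    (s_i, s_j) are killed by n_i and by n_j ([commutator_invariant_annl],
    [commutator_invariant_annr]). Hence the invariants of a class live in the
    right-hand side.
      - They detect coboundaries ([cocycle2_cobound]): if the commutator
        invariants vanish, then E is abelian; if moreover each power invariant
        is a multiple of n_i, then each s_i has a lift of order dividing n_i,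
        and these lifts define a splitting homomorphism from G to E.
      - They take all values ([invariants_surj]): the carry of the addition
        modulo n_i, scaled by a in A, realises the power invariants, and
        b t_i(g) t_j(h), with t_i the i-th coordinate and b killed by n_i and
        n_j, realises the commutator invariants.

    It remains to compare an arbitrary projective resolution P with
    inhomogeneous cocycles. Choose u in P_0 of augmentation 1, then p(g) in P_1
    over gu - u, then q(g,h) in P_2 over g p(h) - p(gh) + p(g). A cocycle f on
    P_2 gives the 2-cocycle f(q(g,h)). It is a coboundary exactly when f is
    ([cochain_cocycle_codiff], [cobound_codiff]), and every 2-cocycle arises in
    this way up to a coboundary ([cochain_cocycle_surj]). For the last point, a
    2-cocycle c defines an extension of the augmentation ideal by A, whose
    action is twisted by c, and lifting the augmentation of P to that extension
    produces f. *)

Set Implicit Arguments.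
Unset Strict Implicit.
Unset Printing Implicit Defensive.

(** * Identities in abelian groups *)

Lemma eq_of_sub0 (V : zmodType) (x y : V) : (0 + (x - y) = 0 -> x = y)%R.
Proof. by rewrite GRing.add0r => /eqP; rewrite GRing.subr_eq0 => /eqP. Qed.

(** Proves an identity between sums of signed atoms: every negated atom is moved
    to the end of the sum, next to its opposite, and cancelled. The bound 20
    keeps a repeated atom from being permuted with its copy for ever. *)
Ltac zmod_cancel := match goal with |- context [ GRing.opp ?x ] =>
  rewrite 20?(GRing.addrAC _ x) 20?(GRing.addrAC _ (GRing.opp x)) GRing.addrK end.
Ltac zmod :=
  apply: eq_of_sub0;
  rewrite ?(GRing.opprD, GRing.opprK, GRing.addrA, GRing.addr0, GRing.oppr0);
  repeat zmod_cancel; done.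

(** * The group ring as a free abelian group *)

Section GroupRingBasis.
Import GRing.Theory.
Local Open Scope ring_scope.
Variable G : finGroupType.
Implicit Types (g h : G) (r s : group_ring G).

Definition gr_basis g : group_ring G := [ffun h => (h == g)%:R].

Lemma gr_basisM g h : gr_basis g * gr_basis h = gr_basis (g * h)%g.
Proof.
apply/ffunP => x; rewrite !ffunE (bigD1 g) //= !ffunE eqxx mul1r.
rewrite big1 ?addr0 => [|y yg]; last by rewrite ffunE (negbTE yg) mul0r.
by rewrite -(inj_eq (mulgI g)) mulKVg.
Qed.

Lemma gr_basis_augmentation g : augmentation (gr_basis g) = 1.
Proof.
rewrite /augmentation (bigD1 g) //= ffunE eqxx big1 ?addr0 // => h hg.
by rewrite ffunE (negbTE hg).
Qed.

Lemma trivial_scaleE (A : zmodType) r (a : trivial_module G A) :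
  r *: a = a *~ augmentation r.
Proof. by []. Qed.

Lemma trivial_basisZ (A : zmodType) g (a : trivial_module G A) :
  gr_basis g *: a = a.
Proof. by rewrite trivial_scaleE gr_basis_augmentation mulr1z. Qed.

(** The universal property of Z[G] as the free abelian group on G. *)
Definition zext (V : zmodType) (F : G -> V) r : V := \sum_g F g *~ r g.

Lemma zextD (V : zmodType) (F : G -> V) : {morph zext F : r s / r + s}.
Proof.
by move=> r s; rewrite -big_split; apply: eq_bigr => g _; rewrite ffunE mulrzDr.
Qed.

Lemma zextB (V : zmodType) (F : G -> V) : {morph zext F : r s / r - s}.
Proof.
move=> r s; rewrite /zext -sumrB; apply: eq_bigr => g _.
by rewrite !ffunE mulrzBr.
Qed.

Lemma zext_basis (V : zmodType) (F : G -> V) g : zext F (gr_basis g) = F g.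
Proof.
rewrite /zext (bigD1 g) //= ffunE eqxx mulr1z big1 ?addr0 // => h hg.
by rewrite ffunE (negbTE hg) mulr0z.
Qed.

Lemma zextM (V : zmodType) (F : G -> V) h r :
  zext F (gr_basis h * r) = zext (fun g => F (h * g)%g) r.
Proof.
rewrite /zext (reindex_inj (mulgI h)); apply: eq_bigr => g _; congr (_ *~ _).
rewrite ffunE (bigD1 h) //= ffunE eqxx mul1r mulKg big1 ?addr0 // => y yh.
by rewrite ffunE (negbTE yh) mul0r.
Qed.

Lemma zext_add (V : zmodType) (E F : G -> V) r :
  zext (fun g => E g + F g) r = zext E r + zext F r.
Proof. by rewrite -big_split; apply: eq_bigr => g _; rewrite mulrzDl. Qed.

Lemma zext_const (V : zmodType) (a : V) r : zext (fun=> a) r = a *~ augmentation r.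
Proof. by rewrite /zext /augmentation -mulrz_sumr. Qed.

Lemma zext_comp (U V : zmodType) (f : {additive U -> V}) (F : G -> U) r :
  f (zext F r) = zext (f \o F) r.
Proof. by rewrite raddf_sum; apply: eq_bigr => g _; rewrite raddfMz. Qed.

Lemma gr_basisE r : r = zext gr_basis r.
Proof.
apply/ffunP => h; rewrite sum_ffunE (bigD1 h) //= big1 => [|g gh].
  by rewrite ffunMzE ffunE eqxx addr0 intz.
by rewrite ffunMzE ffunE eq_sym (negbTE gh) mul0rz.
Qed.

Lemma zext_mul (V : zmodType) (F : G -> V) r s :
  zext F (r * s) = zext (fun h => zext (fun g => F (h * g)%g) s) r.
Proof.
pose Fs := HB.pack_for {additive group_ring G -> V} (zext F)
  (GRing.isZmodMorphism.Build _ _ _ (zextB F)).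
transitivity (Fs (zext (fun h => gr_basis h * s) r)).
  congr (Fs _); rewrite {1}(gr_basisE r) mulr_suml.
  by apply: eq_bigr => h _; rewrite mulrzAl.
by rewrite zext_comp; apply: eq_bigr => h _; rewrite /= zextM.
Qed.

Lemma gr_scaleE (V : lmodType (group_ring G)) r (x : V) :
  r *: x = zext (fun g => gr_basis g *: x) r.
Proof.
rewrite {1}(gr_basisE r) scaler_suml.
by apply: eq_bigr => g _; rewrite scalerMzl.
Qed.

(** Z[G] is spanned additively by G, so linearity may be tested on G. *)
Lemma equivariant_linear (U V : lmodType (group_ring G)) (v : U -> V) :
    {morph v : x y / x + y} ->
    (forall g x, v (gr_basis g *: x) = gr_basis g *: v x) ->
  exists f : {linear U -> V}, f =1 v.
Proof.
move=> vD vE.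
have v0 : v 0 = 0 by apply: (addrI (v 0)); rewrite -vD !addr0.
have vB : zmod_morphism v.
  by move=> x y; apply: (addIr (v y)); rewrite -vD !subrK.
pose va : {additive U -> V} := HB.pack v (GRing.isZmodMorphism.Build U V v vB).
have vZ : linear v.
  move=> r x y; rewrite vD; congr (_ + _).
  rewrite !gr_scaleE; transitivity (va (zext (fun g => gr_basis g *: x) r)) => //.
  by rewrite zext_comp; apply: eq_bigr => g _; rewrite /= vE.
by exists (HB.pack_for {linear U -> V} v (GRing.isLinear.Build (group_ring G) U V _ v vZ)).
Qed.

End GroupRingBasis.

(** * Lifting along maps that need not be surjective *)

Section Lifting.
Import GRing.Theory.
Local Open Scope ring_scope.
Variables (R : nzRingType) (X Y : lmodType R) (g : {linear X -> Y}).

Definition linear_image : {pred Y} := [pred y | `[< exists x, g x = y >]].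

Fact linear_image_closed : submod_closed linear_image.
Proof.
split=> [|c x y]; first by apply/asboolP; exists 0; rewrite raddf0.
move=> /asboolP[a <-] /asboolP[b <-].
by apply/asboolP; exists (c *: a + b); rewrite linearP.
Qed.
HB.instance Definition _ := GRing.isSubmodClosed.Build R Y linear_image
  linear_image_closed.

Definition linear_image_mod : Type := {y : Y | y \in linear_image}.
HB.instance Definition _ := SubChoice.on linear_image_mod.
HB.instance Definition _ := [SubChoice_isSubLmodule of linear_image_mod by <:].

(** The lifting property, applied to g corestricted to its image. In a
    resolution this lifts any map that lands in the image of a differential. *)
Lemma projective_lift (P : lmodType R) (f : {linear P -> Y}) :
  projective P -> (forall p, exists x, g x = f p) ->
  exists h : {linear P -> X}, forall p, g (h p) = f p.
Proof.
move=> Pproj fg.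
have gI x : g x \in linear_image by apply/asboolP; exists x.
have fI p : f p \in linear_image by apply/asboolP; exact: fg.
pose g' x : linear_image_mod := Sub (g x) (gI x).
pose f' p : linear_image_mod := Sub (f p) (fI p).
have g'L : linear g' by move=> c x y; apply: val_inj; rewrite /= linearP.
have f'L : linear f' by move=> c x y; apply: val_inj; rewrite /= linearP.
pose gl := HB.pack_for {linear X -> linear_image_mod} g'
  (GRing.isLinear.Build R X _ _ g' g'L).
pose fl := HB.pack_for {linear P -> linear_image_mod} f'
  (GRing.isLinear.Build R P _ _ f' f'L).
have [|h hP] := Pproj _ _ gl fl.
  by case=> y yI; have /asboolP[x xy] := yI; exists x; apply: val_inj.
by exists h => p; have := congr1 val (hP p).
Qed.
End Lifting.

(** * Inhomogeneous 2-cocycles *)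

Section TwoCocycles.
Import GRing.Theory.
Local Open Scope ring_scope.
Variables (G : finGroupType) (A : zmodType).

Definition cocycle2 (c : G -> G -> A) : Prop :=
  forall g h k, c g h + c (g * h)%g k = c h k + c g (h * k)%g.

Definition cobound2 (w : G -> A) (g h : G) : A := w g + w h - w (g * h)%g.

(** The constant c(1,1) is the whole failure of c to be normalised, so cocycles
    are left unnormalised below and this constant is carried along. *)
Lemma cocycle2_1l c g : cocycle2 c -> c 1%g g = c 1%g 1%g.
Proof.
by move=> cP; have := cP 1%g 1%g g; rewrite !mul1g => /addIr ->.
Qed.

Lemma cocycle2_1r c g : cocycle2 c -> c g 1%g = c 1%g 1%g.
Proof.
by move=> cP; have := cP g 1%g 1%g; rewrite !mulg1 => /addIr ->.
Qed.

End TwoCocycles.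

(** * The extension of the augmentation ideal defined by a 2-cocycle *)

Section AugmentationIdeal.
Import GRing.Theory.
Local Open Scope ring_scope.
Variable G : finGroupType.
Local Notation R := (group_ring G).

Definition aug_ideal_pred : {pred R^o} := [pred r : R^o | augmentation r == 0].

Fact aug_ideal_closed : submod_closed aug_ideal_pred.
Proof.
split=> [|r x y]; rewrite !inE.
  by apply/eqP/big1 => g _; rewrite ffunE.
move=> /eqP x0 /eqP y0; rewrite augmentationD y0 addr0.
by rewrite [augmentation _]augmentationM x0 mulr0.
Qed.
HB.instance Definition _ := GRing.isSubmodClosed.Build R R^o aug_ideal_pred
  aug_ideal_closed.

Definition aug_ideal : Type := {r : R^o | r \in aug_ideal_pred}.
HB.instance Definition _ := SubChoice.on aug_ideal.
HB.instance Definition _ := [SubChoice_isSubLmodule of aug_ideal by <:].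

Lemma aug_idealP (i : aug_ideal) : augmentation (val i) = 0.
Proof. exact/eqP/(valP i). Qed.
End AugmentationIdeal.

Section TwistedModule.
Import GRing.Theory.
Local Open Scope ring_scope.
Variables (G : finGroupType) (A : zmodType) (c : G -> G -> A).
Local Notation R := (group_ring G).
Implicit Types (r s : R) (i j : aug_ideal G).

(** The biadditive extension of c to Z[G] x I, with I the augmentation ideal. *)
Definition cocycle_form r i : A := zext (fun h => zext (c h) (val i)) r.

Lemma cocycle_formDl r s i :
  cocycle_form (r + s) i = cocycle_form r i + cocycle_form s i.
Proof. exact: zextD. Qed.

Lemma cocycle_formDr r i j :
  cocycle_form r (i + j) = cocycle_form r i + cocycle_form r j.
Proof.
by rewrite -zext_add; apply: eq_bigr => h _; rewrite raddfD zextD.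
Qed.

(** The cocycle identity for (h, k, g), summed over the coefficients of an
    element i of the augmentation ideal: the term c(h,k), which does not depend
    on g, is multiplied by the augmentation of i, hence disappears. *)
Lemma cocycle_formM r s i : cocycle2 c ->
  cocycle_form (r * s) i = cocycle_form s i *~ augmentation r + cocycle_form r (s *: i).
Proof.
move=> cP; rewrite /cocycle_form zext_mul -zext_const -zext_add.
apply: eq_bigr => h _; congr (_ *~ _).
rewrite [val (s *: i)](_ : _ = s * val i) // zext_mul -zext_add.
apply: eq_bigr => k _; congr (_ *~ _); rewrite -zext_add.
(* Write 0 as the sum of the constant c h k over the coefficients of i. *)
rewrite -[LHS]add0r -[X in X + _](mulr0z (c h k)) -(aug_idealP i) -zext_const.
rewrite -zext_add; apply: eq_bigr => g _; congr (_ *~ _); exact: cP.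
Qed.

(** The extension of the augmentation ideal by A in which g acts by
    g (a, i) = (a + c(g, i), g i). This is the image of the class of c under
    H^2(G, A) = Ext^1(I, A). The proof of the cocycle identity is a parameter
    because the module laws depend on it. *)
Definition twisted (_ : cocycle2 c) : Type := (A * aug_ideal G)%type.

Variable cP : cocycle2 c.
HB.instance Definition _ := GRing.Zmodule.on (twisted cP).

Let scale r (m : twisted cP) : twisted cP :=
  (m.1 *~ augmentation r + cocycle_form r m.2, r *: m.2).

Fact twisted_scaleA r s m : scale r (scale s m) = scale (r * s) m.
Proof.
congr pair; last exact: scalerA.
rewrite /= cocycle_formM // augmentationM mulrzDl mulrzA mulrzAC.
by rewrite addrA.
Qed.

Fact twisted_scale1 : left_id 1 scale.
Proof.
case=> a i; congr pair; last exact: scale1r.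
rewrite augmentation1 mulr1z /= [1](_ : _ = gr_basis 1%g).
  rewrite /cocycle_form zext_basis (_ : zext _ _ = 0) ?addr0 //.
  rewrite -(mulr0z (c 1%g 1%g)) -(aug_idealP i) -zext_const.
  by apply: eq_bigr => g _; rewrite (cocycle2_1l _ cP).
by apply/ffunP => g; rewrite !ffunE.
Qed.

Fact twisted_scaleDr : right_distributive scale +%R.
Proof.
move=> r m n; congr pair; last exact: scalerDr.
by rewrite /= cocycle_formDr mulrzDl addrACA.
Qed.

Fact twisted_scaleDl m : {morph scale^~ m : r s / r + s}.
Proof.
move=> r s; congr pair; last exact: scalerDl.
by rewrite cocycle_formDl augmentationD mulrzDr addrACA.
Qed.

HB.instance Definition _ := GRing.Zmodule_isLmodule.Build R (twisted cP)
  twisted_scaleA twisted_scale1 twisted_scaleDr twisted_scaleDl.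

Definition twisted_proj (m : twisted cP) : R^o := val m.2.

Fact twisted_proj_linear : linear twisted_proj.
Proof.
move=> r m n; rewrite /twisted_proj.
by rewrite [(r *: m + n).2](_ : _ = r *: m.2 + n.2) // raddfD.
Qed.
HB.instance Definition _ := GRing.isLinear.Build R (twisted cP) R^o _
  twisted_proj twisted_proj_linear.
End TwistedModule.

(** * Comparison of a projective resolution with 2-cocycles *)

Section Comparison.
Import GRing.Theory.
Local Open Scope ring_scope.
Variables (G : finGroupType) (A : zmodType).
Local Notation R := (group_ring G).
Local Notation triv := (trivial_module G).
Variable P : projective_resolution (triv int).

Local Notation d0 := (res_diff P 0).
Local Notation d1 := (res_diff P 1).
Local Notation d2 := (res_diff P 2).

(** A chain map from the bar resolution to P in degrees at most 2, given on the
    bases: u, p g and q g h are the images of [], [g] and [g|h]. *)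
Record bar_lift := BarLift {
  bl_u : P 0;
  bl_p : G -> P 1;
  bl_q : G -> G -> P 2;
  bl_uE : res_aug P bl_u = 1;
  bl_pE : forall g, d0 (bl_p g) = gr_basis g *: bl_u - bl_u;
  bl_qE : forall g h,
    d1 (bl_q g h) = gr_basis g *: bl_p h - bl_p (g * h)%g + bl_p g }.

Lemma diff_diff n x : res_diff P n (res_diff P n.+1 x) = 0.
Proof. by apply/res_exactS; exists x. Qed.

Lemma aug_diff x : res_aug P (d0 x) = 0.
Proof. by apply/res_exact0; exists x. Qed.

Lemma bar_lift_exists : inhabited bar_lift.
Proof.
have [u uE] := res_aug_surj P 1.
have /choice[p pE] g : exists y, d0 y = gr_basis g *: u - u.
  by apply/res_exact0; rewrite raddfB /= linearZ /= trivial_basisZ subrr.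
have /choice[q qE] gh : exists y, d1 y =
    gr_basis gh.1 *: p gh.2 - p (gh.1 * gh.2)%g + p gh.1.
  case: gh => g h /=; apply/res_exactS.
  rewrite !raddfD raddfN /= linearZ /= !pE -gr_basisM -scalerA scalerBr opprB.
  by zmod.
by split; exists u p (fun g h => q (g, h)) => // g h; rewrite qE.
Qed.

Variable b : bar_lift.
Local Notation u := (bl_u b).
Local Notation p := (bl_p b).
Local Notation q := (bl_q b).

Implicit Types f : {linear P 2 -> triv A}.

Definition cochain_cocycle f (g h : G) : A := f (q g h).

Lemma cocycle_diff f : f \in @cocycles R _ P 2 (triv A) -> forall x, f (d2 x) = 0.
Proof.
by move=> /eqP fc x; have := congr1 (fun l : {linear _ -> _} => l x) fc.
Qed.

Lemma cochain_cocycleP f : f \in @cocycles R _ P 2 (triv A) ->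
  cocycle2 (cochain_cocycle f).
Proof.
move=> /cocycle_diff fd g h k; rewrite /cochain_cocycle.
(* The image in P of the differential of the bar cell [g|h|k]. *)
pose z := gr_basis g *: q h k + q g (h * k)%g - q g h - q (g * h)%g k.
have [y yE] : exists y, d2 y = z.
  apply/res_exactS.
  rewrite /z !raddfB raddfD /= linearZ /= !bl_qE -gr_basisM mulgA.
  by rewrite !scalerDr !scalerN scalerA gr_basisM; zmod.
have := fd y.
rewrite yE /z !raddfB raddfD /= linearZ /= trivial_basisZ -addrA -opprD => /eqP.
by rewrite subr_eq0 => /eqP ->.
Qed.

Lemma cocycle_factor f : f \in @cocycles R _ P 2 (triv A) ->
  forall x y, d1 x = d1 y -> f x = f y.
Proof.
move=> /cocycle_diff fd x y /eqP; rewrite -subr_eq0 -raddfB => /eqP/res_exactS[z zE].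
by have /eqP := fd z; rewrite zE raddfB subr_eq0 => /eqP.
Qed.

Lemma cochain_cocycle_codiff (v : {linear P 1 -> triv A}) g h :
  cochain_cocycle (codiff v) g h = cobound2 (v \o p) g h.
Proof.
rewrite /cochain_cocycle /cobound2 /= bl_qE raddfD raddfB /= linearZ /=.
by rewrite trivial_basisZ; zmod.
Qed.

Lemma augmentation_is_linear : linear (@augmentation G : R^o -> triv int).
Proof.
move=> r x y; rewrite augmentationD augmentationM; congr (_ + _).
by rewrite /GRing.scale /= mulrzz mulrC.
Qed.

(** The degree 0 part of a chain map from P to the bar resolution. *)
Lemma aug_to_group_ring :
  exists phi : {linear P 0 -> R^o}, forall x, augmentation (phi x) = res_aug P x.
Proof.
pose eps := HB.pack_for {linear R^o -> triv int} (@augmentation G : R^o -> triv int)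
  (GRing.isLinear.Build R R^o (triv int) _ _ augmentation_is_linear).
have [|phi phiE] := @res_projective _ _ P 0 _ _ eps (res_aug P).
  move=> m; exists (gr_basis 1%g *~ (m : int)).
  rewrite raddfMz /= gr_basis_augmentation.
  exact: intz.
by exists phi.
Qed.

(** Let s be a homotopy from the identity of P_0 to its factorisation phi(-)u
    through Z[G]. For x in P_1, put i(x) = phi(d0 x), an element of the
    augmentation ideal; then x - s(d0 x) - p(i(x)) is a cycle, hence of the form
    d1(z(x)), and v(x) = f(z(x)) + w(i(x)) is the required primitive. It is
    equivariant because g p(h) - p(gh) = d1(q(g,h)) - p(g), while f(q(g,h)) is
    dw(g,h) by hypothesis; the terms p(g) and w(g) get the augmentation of i(x),
    which is 0, as coefficient. *)
Lemma cobound_codiff f (w : G -> A) : f \in @cocycles R _ P 2 (triv A) ->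
    (forall g h, cochain_cocycle f g h = cobound2 w g h) ->
  exists v : {linear P 1 -> triv A}, f = codiff v.
Proof.
move=> fc fw; have [phi phiE] := aug_to_group_ring.
have [s sE] : exists s : {linear P 0 -> P 1},
    forall x, d0 (s x) = x - (phi x : R) *: u.
  have lin : linear (fun x : P 0 => x - (phi x : R) *: u).
    move=> r x y.
    have -> : phi (r *: x + y) = r * phi x + phi y :> R by rewrite linearP.
    by rewrite scalerDl scalerBr scalerA; zmod.
  pose l := HB.pack_for {linear P 0 -> P 0} (fun x : P 0 => x - (phi x : R) *: u)
    (GRing.isLinear.Build R _ _ _ _ lin).
  apply: (projective_lift (f := l) (@res_projective _ _ P 0)) => x.
  apply/res_exact0; rewrite /= raddfB /= linearZ /= bl_uE.
  by rewrite trivial_scaleE phiE [_ *~ _]intz subrr.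
pose i x : R := phi (d0 x).
have augi x : augmentation (i x) = 0 by rewrite /i phiE aug_diff.
have iD x y : i (x + y) = i x + i y by rewrite /i !raddfD.
have iZ r x : i (r *: x) = r * i x by rewrite /i !linearZ.
have d0T r : d0 (zext p r) = r *: u - u *~ augmentation r.
  rewrite (zext_comp d0) gr_scaleE -(zext_const u).
  by rewrite -sumrB; apply: eq_bigr => g _; rewrite /= bl_pE mulrzBl.
have /choice[z zE] x : exists z, d1 z = x - s (d0 x) - zext p (i x).
  apply/res_exactS; rewrite !raddfB /= sE d0T augi mulr0z subr0.
  by rewrite /i; zmod.
pose v x : triv A := f (z x) + zext w (i x).
have vD x y : v (x + y) = v x + v y.
  have zD : f (z (x + y)) = f (z x) + f (z y).
    rewrite -raddfD; apply: cocycle_factor => //.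
    by rewrite raddfD /= !zE !raddfD /= iD zextD; zmod.
  by rewrite /v iD zextD zD; zmod.
have vE h x : v (gr_basis h *: x) = gr_basis h *: v x.
  pose e := zext (q h) (i x).
  have zh : f (z (gr_basis h *: x)) = f (z x) + f e.
    rewrite -[f (z x)](trivial_basisZ h) -linearZ -raddfD.
    apply: cocycle_factor => //.
    have d1e : d1 e = gr_basis h *: zext p (i x) - zext p (gr_basis h * i x).
      rewrite /e (zext_comp d1) zextM.
      pose hs := HB.pack_for {additive P 1 -> P 1} ( *:%R (gr_basis h) )
        (GRing.isZmodMorphism.Build _ _ _ (scalerBr (gr_basis h))).
      rewrite [_ *: zext _ _](zext_comp hs).
      (* Write 0 as the sum of the constant p h over the coefficients of i x. *)
      rewrite -[LHS]subr0 -[X in _ - X](mulr0z (p h)) -(augi x) -zext_const.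
      rewrite -!sumrB; apply: eq_bigr => g _ /=.
      by rewrite bl_qE mulrzDl mulrzBl addrK.
    rewrite raddfD /= d1e linearZ /= !zE iZ.
    by rewrite !linearZ /= !scalerDr !scalerN; zmod.
  rewrite trivial_basisZ /v zh iZ zextM -addrA; congr (_ + _).
  rewrite /e (zext_comp f) -[LHS]subr0.
  rewrite -[X in _ - X](mulr0z (w h)) -(augi x) -zext_const.
  rewrite -zext_add -sumrB; apply: eq_bigr => g _ /=.
  by rewrite -mulrzBl; congr (_ *~ _); rewrite [f _]fw /cobound2; zmod.
have [vl vlE] := equivariant_linear vD vE.
exists vl; apply: linear_ext => y /=; rewrite vlE /v.
have d00 : d0 (d1 y) = 0 by exact: diff_diff.
have i0 : i (d1 y) = 0 by rewrite /i d00 raddf0.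
rewrite -[LHS]addr0 i0; congr (_ + _).
  apply: cocycle_factor => //; rewrite zE d00 i0 raddf0.
  by rewrite /zext big1 ?subr0 // => g _; rewrite ffunE mulr0z.
by rewrite /zext big1 // => g _; rewrite ffunE mulr0z.
Qed.

(** Lift phi to a map phi1 from P_1 to the twisted extension of the augmentation
    ideal. On boundaries, phi1 takes its values in A, and f = phi1 d1 is the
    cocycle looked for. The discrepancy w measures phi1(p g) and the choice of
    rho = phi(u), which has augmentation 1 but need not be 1. *)
Lemma cochain_cocycle_surj (c : G -> G -> A) : cocycle2 c ->
  exists2 f, f \in @cocycles R _ P 2 (triv A) &
    exists w, forall g h, cochain_cocycle f g h = c g h + cobound2 w g h.
Proof.
move=> cP; have [phi phiE] := aug_to_group_ring.
have phi_p x : exists m : twisted cP, twisted_proj m = (phi \o d0) x.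
  have xI : phi (d0 x) \in @aug_ideal_pred G by rewrite inE phiE aug_diff.
  by exists (0, Sub (phi (d0 x)) xI).
have [phi1 phi1E] := projective_lift (@res_projective _ _ P 1) phi_p.
have snd0 x : (phi1 (d1 x)).2 = 0.
  by apply: val_inj; rewrite [LHS]phi1E /= diff_diff !raddf0.
pose fv x : triv A := (phi1 (d1 x)).1.
have fL : linear fv.
  move=> r x y; rewrite /fv !linearP /= snd0.
  rewrite trivial_scaleE; congr (_ + _); rewrite -[RHS]addr0; congr (_ + _).
  by apply: big1 => h _; rewrite /zext big1 ?mul0rz // => g _; rewrite ffunE mulr0z.
pose f := HB.pack_for {linear P 2 -> triv A} fv
  (GRing.isLinear.Build R _ _ _ _ fL).
exists f; first by apply/eqP/linear_ext => x; rewrite /= /fv diff_diff raddf0.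
pose rho : R := phi u; pose gam g := zext (c g) rho.
exists (fun g => (phi1 (p g)).1 - gam g) => g h.
(* The lift of h - 1 in the twisted extension is (h - 1)rho rather than h - 1;
   expanding it with the cocycle identity at (g, h, k), weighted by the
   coefficients of rho, costs the coboundary of gam. *)
have form : cocycle_form c (gr_basis g) (phi1 (p h)).2 =
    c g h + gam (g * h)%g - gam h - gam g.
  rewrite /cocycle_form zext_basis.
  have -> : val (phi1 (p h)).2 = gr_basis h * rho - rho.
    by rewrite [LHS]phi1E /= bl_pE raddfB /= linearZ.
  have aug1 : augmentation rho = 1 by rewrite /rho phiE bl_uE.
  rewrite zextB zextM -[c g h]mulr1z -aug1 -zext_const /gam.
  rewrite /zext -!sumrN -!big_split; apply: eq_bigr => k _ /=.
  rewrite -!mulNrz -!mulrzDl; congr (_ *~ _).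
  by rewrite cP; zmod.
rewrite /cochain_cocycle /= /fv bl_qE raddfD raddfB /= linearZ /= /cobound2.
rewrite form gr_basis_augmentation mulr1z.
by zmod.
Qed.
End Comparison.

(** * The commutator of an extension *)

Section CocycleOps.
Import GRing.Theory.
Local Open Scope ring_scope.
Variables (G : finGroupType) (A : zmodType).
Implicit Types c : G -> G -> A.

Lemma cocycle2_sum (J : finType) (F : J -> G -> G -> A) :
  (forall j, cocycle2 (F j)) -> cocycle2 (fun g h => \sum_j F j g h).
Proof.
by move=> FP g h k; rewrite -!big_split; apply: eq_bigr => j _; exact: FP.
Qed.

Lemma cocycle2D c c' :
  cocycle2 c -> cocycle2 c' -> cocycle2 (fun g h => c g h + c' g h).
Proof. by move=> cP cP' g h k; rewrite addrACA cP cP' addrACA. Qed.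

Definition commutator_form c g h : A := c g h - c h g.

(** The commutator pairing of the central extension with factor set c; it is
    bimultiplicative because its values are central. On cocycles this is a
    combination of the three instances of the cocycle identity at (g,h,k),
    (k,g,h) and (g,k,h). *)
Lemma commutator_formM c : cocycle2 c -> (forall g h : G, (g * h = h * g)%g) ->
  forall g h k, commutator_form c (g * h)%g k =
                commutator_form c g k + commutator_form c h k.
Proof.
move=> cP comm g h k; rewrite /commutator_form.
have e1 : c (g * h)%g k = c h k + c g (h * k)%g - c g h.
  by rewrite -cP addrC addKr.
have e2 : c k (g * h)%g = c k g + c (k * g)%g h - c g h.
  by rewrite cP addrC addKr.
have e3 : c (k * g)%g h = c k h + c g (h * k)%g - c g k.
  by rewrite (comm h k) -cP addrC addKr comm.
by rewrite e1 e2 e3; zmod.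
Qed.

End CocycleOps.

(** * The abelian extension defined by a symmetric 2-cocycle *)

Section AbelianExtension.
Import GRing.Theory.
Local Open Scope ring_scope.
Variables (G : finGroupType) (A : zmodType) (c : G -> G -> A).

(** Written additively, with elements (a, g). The zero is (-c(1,1), 1) because
    c is not assumed to be normalised. *)
Definition abelian_ext (_ : cocycle2 c) (_ : forall g h, c g h = c h g)
  (_ : forall g h : G, (g * h = h * g)%g) : Type := (A * G)%type.

Variables (cP : cocycle2 c) (cS : forall g h, c g h = c h g).
Variable comm : forall g h : G, (g * h = h * g)%g.
Local Notation E := (abelian_ext cP cS comm).

HB.instance Definition _ := Choice.on E.

Let zero : E := (- c 1%g 1%g, 1%g).
Let add (x y : E) : E := (x.1 + y.1 + c x.2 y.2, (x.2 * y.2)%g).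

Fact abelian_ext_addA : associative add.
Proof.
move=> x y z; congr pair; last exact: mulgA.
rewrite /= [LHS](_ : _ = x.1 + y.1 + z.1 + (c y.2 z.2 + c x.2 (y.2 * z.2)%g)).
  by rewrite -cP; zmod.
by zmod.
Qed.

Fact abelian_ext_addC : commutative add.
Proof. by move=> x y; rewrite /add cS comm [x.1 + _]addrC. Qed.

Fact abelian_ext_add0 : left_id zero add.
Proof.
case=> a g; rewrite /add /= mul1g (cocycle2_1l _ cP); congr pair.
by zmod.
Qed.

HB.instance Definition _ := GRing.isNmodule.Build E
  abelian_ext_addA abelian_ext_addC abelian_ext_add0.

Lemma abelian_extDE (x y : E) : x + y = (x.1 + y.1 + c x.2 y.2, (x.2 * y.2)%g).
Proof. by []. Qed.

Lemma abelian_ext0E : 0 = (- c 1%g 1%g, 1%g) :> E.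
Proof. by []. Qed.

(** For x.2 = s_i and m = n_i, the sum over l is the power invariant: this is
    how that invariant decides whether a lift of s_i has order dividing n_i. *)
Lemma abelian_extMn (x : E) m : x *+ m =
  (x.1 *+ m + \sum_(l < m) c (x.2 ^+ l)%g x.2 - c 1%g 1%g, (x.2 ^+ m)%g).
Proof.
elim: m => [|m IH]; first by rewrite !mulr0n big_ord0 abelian_ext0E; congr pair; zmod.
rewrite mulrSr IH abelian_extDE /= -expgSr big_ord_recr mulrSr /=.
by congr pair; zmod.
Qed.

Lemma abelian_ext_sum2 (J : finType) (F : J -> E) :
  (\sum_j F j).2 = (\prod_j (F j).2)%g.
Proof. by rewrite (big_morph (fun x : E => x.2) (id1 := 1%g) (op1 := mulg)). Qed.

End AbelianExtension.

(** * Power and commutator invariants of a product of cyclic groups *)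

Lemma mulrn_modn (V : nmodType) (x : V) d m :
  (x *+ d = 0 -> x *+ (m %% d)%N = x *+ m)%R.
Proof.
move=> xd; rewrite {2}(divn_eq m d) GRing.mulrnDr mulnC GRing.mulrnA xd.
by rewrite GRing.mul0rn GRing.add0r.
Qed.

Lemma mulrn_modM (V : nmodType) (x : V) d m l :
  (x *+ d = 0 -> x *+ (m %% d * l)%N = x *+ (m * l)%N)%R.
Proof. by move=> xd; rewrite !GRing.mulrnA mulrn_modn. Qed.

Section CyclicCoordinates.
Import GRing.Theory.
Local Open Scope ring_scope.

(** A decomposition of G as a product of cyclic groups of orders n_i, recorded
    by natural number coordinates so that no dependent type is involved. The
    remainder in cc_coord_gen is, for i = j, equal to 1 unless n_i = 1, when the generator is
    trivial and its coordinate is 0. *)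
Record cyclic_coordinates (G : finGroupType) (I : finType) (n : I -> nat) :=
  CyclicCoordinates {
    cc_gen : I -> G;
    cc_coord : I -> G -> nat;
    cc_ord_gt0 : forall i, (0 < n i)%N;
    cc_coordM : forall i g h,
      cc_coord i (g * h)%g = ((cc_coord i g + cc_coord i h) %% n i)%N;
    cc_coord_gen : forall i j, cc_coord i (cc_gen j) = ((i == j) %% n i)%N;
    cc_inj : forall g h, (forall i, cc_coord i g = cc_coord i h) -> g = h }.

Variables (G : finGroupType) (I : finType) (n : I -> nat).
Variable C : cyclic_coordinates G n.
Local Notation s := (cc_gen C).
Local Notation t := (cc_coord C).

Lemma coord_lt i g : (t i g < n i)%N.
Proof. by rewrite -[g]mulg1 cc_coordM ltn_pmod // (cc_ord_gt0 C). Qed.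

Lemma coord1 i : t i 1%g = 0%N.
Proof.
have := cc_coordM C i 1%g 1%g; rewrite mulg1 -{1}(modn_small (coord_lt i 1%g)).
move/eqP; rewrite -{1}[t i 1%g]addn0 eqn_modDl mod0n modn_small ?coord_lt //.
by move/eqP.
Qed.

Lemma coordX i g m : t i (g ^+ m)%g = ((m * t i g) %% n i)%N.
Proof.
elim: m => [|m IH]; first by rewrite expg0 coord1 mod0n.
by rewrite expgS cc_coordM IH modnDmr mulSn.
Qed.

Lemma coord_comm (g h : G) : (g * h = h * g)%g.
Proof. by apply: (cc_inj (c := C)) => i; rewrite !cc_coordM addnC. Qed.

Lemma gen_expg i : (s i ^+ n i = 1)%g.
Proof.
apply: (cc_inj (c := C)) => j; rewrite coordX coord1 cc_coord_gen.
have [->|ji] := eqVneq j i; first by rewrite modnMr.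
by rewrite mod0n muln0 mod0n.
Qed.

Lemma coord_prod g : (g = \prod_i s i ^+ t i g)%g.
Proof.
apply: (cc_inj (c := C)) => j.
have tE : t j (\prod_i s i ^+ t i g)%g = ((\sum_i (t i g * (j == i))) %% n j)%N.
  apply: (big_rec2 (fun x y => t j x = (y %% n j)%N)).
    by rewrite coord1 mod0n.
  move=> i x y _ IH; rewrite cc_coordM IH coordX cc_coord_gen.
  by rewrite modnMmr modnDm.
rewrite tE (bigD1 j) //= eqxx muln1 big1 ?addn0 ?modn_small ?coord_lt //.
by move=> i ij; rewrite eq_sym (negbTE ij) muln0.
Qed.

Lemma coord_ind (Q : G -> Prop) :
    Q 1%g -> (forall g h, Q g -> Q h -> Q (g * h)%g) -> (forall i, Q (s i)) ->
  forall g, Q g.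
Proof.
move=> Q1 QM Qs g; rewrite (coord_prod g); apply: (big_ind Q) => // i _.
by elim: (t i g) => [|m IH]; rewrite ?expg0 // expgS; apply: QM.
Qed.

Variable A : zmodType.
Implicit Types c : G -> G -> A.

Definition power_invariant c i : A := \sum_(m < n i) c (s i ^+ m)%g (s i).

Definition commutator_invariant c i j : A := commutator_form c (s i) (s j).

(** The sum telescopes along the cycle 1, s_i, ..., s_i^(n_i) = 1. *)
Lemma power_invariant_cobound (w : G -> A) i :
  power_invariant (cobound2 w) i = w (s i) *+ n i.
Proof.
rewrite /power_invariant /cobound2.
under eq_bigr => m _ do rewrite -expgSr addrAC addrC -opprB.
rewrite big_split /= sumr_const card_ord sumrN.
rewrite -(big_mkord predT (fun m => w (s i ^+ m.+1)%g - w (s i ^+ m)%g)).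
by rewrite telescope_sumr // gen_expg expg0 subrr subr0.
Qed.

Lemma commutator_invariant_cobound (w : G -> A) i j :
  commutator_invariant (cobound2 w) i j = 0.
Proof.
rewrite /commutator_invariant /commutator_form /cobound2 [(s j * _)%g]coord_comm.
by zmod.
Qed.

Lemma commutator_formX c g h m : cocycle2 c ->
  commutator_form c (g ^+ m)%g h = commutator_form c g h *+ m.
Proof.
move=> cP; elim: m => [|m IH].
  by rewrite /commutator_form (cocycle2_1l _ cP) (cocycle2_1r _ cP) subrr.
by rewrite expgS commutator_formM // ?IH ?mulrS //; exact: coord_comm.
Qed.

Lemma commutator_formC c g h : commutator_form c g h = - commutator_form c h g.
Proof. by rewrite opprB. Qed.

Lemma commutator_invariant_annl c i j : cocycle2 c ->
  commutator_invariant c i j *+ n i = 0.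
Proof.
move=> cP; rewrite -commutator_formX // gen_expg.
by rewrite /commutator_form (cocycle2_1l _ cP) (cocycle2_1r _ cP) subrr.
Qed.

Lemma commutator_invariant_annr c i j : cocycle2 c ->
  commutator_invariant c i j *+ n j = 0.
Proof.
move=> cP; rewrite /commutator_invariant commutator_formC mulNrn.
by rewrite [X in - X]commutator_invariant_annl ?oppr0.
Qed.

(** The commutator pairing is bimultiplicative and vanishes on generators. *)
Lemma cocycle2_symmetric c : cocycle2 c ->
  (forall i j, commutator_invariant c i j = 0) -> forall g h, c g h = c h g.
Proof.
move=> cP c0.
have b1 h : commutator_form c 1%g h = 0.
  by rewrite -(expg0 1%g) commutator_formX.
have bM g h k : commutator_form c g k = 0 -> commutator_form c h k = 0 ->
    commutator_form c (g * h)%g k = 0.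
  by rewrite commutator_formM // => [->->|]; rewrite ?addr0 //; exact: coord_comm.
have bs i g : commutator_form c g (s i) = 0.
  by move: g; apply: coord_ind => //; [move=> g h; exact: bM|move=> j; exact: c0].
move=> g h; apply/eqP; rewrite -subr_eq0; apply/eqP.
move: g; apply: coord_ind => [||i]; [exact: b1|move=> x y; exact: bM|].
by rewrite -[LHS]opprK opprB [X in - X]bs oppr0.
Qed.

(** By symmetry of c the extension E is abelian. The hypothesis on the power
    invariants says that the lift (-a_i, s_i) of s_i is killed by n_i, so that
    sending g to the sum of its coordinates times these lifts is a homomorphic
    section S of E over G; its first component is a primitive of -c. *)
Lemma cocycle2_cobound c (a : I -> A) : cocycle2 c ->
    (forall i, power_invariant c i = a i *+ n i) ->
    (forall i j, commutator_invariant c i j = 0) ->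
  exists w, forall g h, c g h = cobound2 w g h.
Proof.
move=> cP cpow /(cocycle2_symmetric cP) cS.
pose E := abelian_ext cP cS coord_comm.
pose e i : E := (- a i, s i).
have e0 i : e i *+ n i = 0.
  rewrite abelian_extMn /= [\sum_(_ < _) _](cpow i) gen_expg abelian_ext0E.
  by congr pair; rewrite mulNrn; zmod.
pose S g : E := \sum_i e i *+ t i g.
have S2 g : (S g).2 = g.
  rewrite [in RHS](coord_prod g) abelian_ext_sum2.
  by apply: eq_bigr => i _; rewrite abelian_extMn.
have SM g h : S (g * h)%g = S g + S h.
  rewrite -big_split; apply: eq_bigr => i _ /=.
  by rewrite cc_coordM mulrn_modn ?mulrnDr.
exists (fun g => - (S g).1) => g h.
by rewrite /cobound2 SM abelian_extDE /= !S2; zmod.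
Qed.

(** The factor set of the extension of Z/n_i by A in which the n_i-th power of
    the generator is a, pulled back to G along the i-th coordinate. *)
Definition carry_cocycle (a : A) i g h : A := a *+ ((t i g + t i h) %/ n i)%N.

Lemma carry_cocycleP a i : cocycle2 (carry_cocycle a i).
Proof.
have gt0 := cc_ord_gt0 C i.
move=> g h k; rewrite /carry_cocycle !cc_coordM -!mulrnDr; congr (_ *+ _).
have carryl x y z : ((x + y) %/ n i + ((x + y) %% n i + z) %/ n i = (x + y + z) %/ n i)%N.
  by rewrite [in RHS](divn_eq (x + y) (n i)) -addnA divnMDl.
by rewrite carryl [(t i g + _ %% _)%N]addnC carryl -addnA addnC.
Qed.

(** For i = j, multiplied by n_j, each carry is the difference between the sum of two
    coordinates and the coordinate of the product, and the coordinates of the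
    powers of s_j telescope. *)
Lemma power_invariant_carry a i j :
  power_invariant (carry_cocycle a i) j = a *+ t i (s j).
Proof.
have gt0 := cc_ord_gt0 C i.
rewrite /power_invariant /carry_cocycle sumrMnr; congr (_ *+ _).
have [->|ij] := eqVneq i j; last first.
  rewrite cc_coord_gen (negbTE ij) mod0n; apply: big1 => m _.
  by rewrite coordX cc_coord_gen (negbTE ij) mod0n muln0 mod0n div0n.
have gt0j := cc_ord_gt0 C j; pose x m := t j (s j ^+ m)%g.
have shift : (\sum_(m < n j) x m.+1 = \sum_(m < n j) x m)%N.
  have x0 : x 0%N = 0%N by rewrite /x expg0 coord1.
  have xn : x (n j) = 0%N by rewrite /x gen_expg coord1.
  rewrite -(big_mkord predT (fun m => x m.+1)) -(big_mkord predT x).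
  by rewrite -[LHS]add0n -{1}x0 -big_nat_recl // big_nat_recr //= xn addn0.
apply/eqP; rewrite -(eqn_pmul2r gt0j) big_distrl /= -(eqn_add2r (\sum_(m < n j) x m)).
rewrite -{1}shift -big_split /=; apply/eqP.
transitivity (\sum_(m < n j) (x m + t j (s j)))%N.
  apply: eq_bigr => m _; rewrite [RHS](divn_eq _ (n j)).
  by rewrite /x expgSr cc_coordM.
by rewrite big_split /= sum_nat_const card_ord addnC mulnC.
Qed.

Lemma commutator_invariant_carry a i j l :
  commutator_invariant (carry_cocycle a i) j l = 0.
Proof.
by rewrite /commutator_invariant /commutator_form /carry_cocycle addnC subrr.
Qed.

Definition product_cocycle (b : A) i j g h : A := b *+ (t i g * t j h)%N.

Lemma product_cocycleP b i j : b *+ n i = 0 -> b *+ n j = 0 ->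
  cocycle2 (product_cocycle b i j).
Proof.
move=> bi bj g h k; rewrite /product_cocycle !cc_coordM.
rewrite mulrn_modM // [(t i g * (_ %% _))%N]mulnC mulrn_modM // -!mulrnDr.
congr (_ *+ _); rewrite !mulnDl addnA addnC.
by rewrite [(t j h * _)%N]mulnC [(t j k * _)%N]mulnC.
Qed.

Lemma power_invariant_product b i j l : i != j ->
  power_invariant (product_cocycle b i j) l = 0.
Proof.
move=> ij; apply: big1 => m _; rewrite /product_cocycle coordX !cc_coord_gen.
have [il|_] := eqVneq i l; last by rewrite mod0n muln0 mod0n mul0n.
by rewrite [j == l](_ : _ = false) ?mod0n ?muln0 // -il eq_sym (negbTE ij).
Qed.

Lemma commutator_invariant_product b i j l m : b *+ n i = 0 -> b *+ n j = 0 ->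
  commutator_invariant (product_cocycle b i j) l m =
  b *+ ((i == l) && (j == m)) - b *+ ((i == m) && (j == l)).
Proof.
move=> bi bj; rewrite /commutator_invariant /commutator_form /product_cocycle.
rewrite !cc_coord_gen.
have bE (x y : bool) : b *+ (x %% n i * (y %% n j))%N = b *+ (x && y).
  by rewrite mulrn_modM // mulnC mulrn_modM // mulnb andbC.
by rewrite !bE.
Qed.

Lemma invariants_surj (a : I -> A) (b : I -> I -> A) :
    (forall i j, b i j *+ n i = 0) -> (forall i j, b i j *+ n j = 0) ->
    (forall i, b i i = 0) ->
  exists2 c, cocycle2 c &
    (forall i, power_invariant c i = a i *+ (1 %% n i)) /\
    (forall i j, commutator_invariant c i j = b i j - b j i).
Proof.
move=> bl br b0.
pose c1 g h := \sum_i carry_cocycle (a i) i g h.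
pose c2 g h := \sum_(p : I * I) product_cocycle (b p.1 p.2) p.1 p.2 g h.
exists (fun g h => c1 g h + c2 g h).
  apply: cocycle2D; apply: cocycle2_sum => j; first exact: carry_cocycleP.
  exact: product_cocycleP.
split=> [i|i j].
  rewrite /power_invariant big_split /= exchange_big [X in _ + X]exchange_big /=.
  rewrite [X in _ + X]big1 ?addr0 => [|[j l] _]; last first.
    have [->|jl] /= := eqVneq j l; last exact: power_invariant_product.
    by apply: big1 => m _; rewrite /product_cocycle b0 mul0rn.
  rewrite (bigD1 i) //= [X in _ + X]big1 ?addr0 => [|j ji].
    by rewrite [LHS]power_invariant_carry cc_coord_gen eqxx.
  by rewrite [LHS]power_invariant_carry cc_coord_gen (negbTE ji) mod0n.
rewrite /commutator_invariant /commutator_form opprD addrACA -!sumrB.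
rewrite [X in X + _]big1 ?add0r => [|l _]; last exact: commutator_invariant_carry.
rewrite (eq_bigr (fun p => b p.1 p.2 *+ ((p.1 == i) && (p.2 == j))
    - b p.1 p.2 *+ ((p.1 == j) && (p.2 == i)))); last first.
  by move=> p _; exact: commutator_invariant_product.
rewrite big_split /= sumrN; congr (_ - _).
  rewrite (bigD1 (i, j)) //= !eqxx big1 ?addr0 // => -[x y] /=.
  by rewrite xpair_eqE => /negbTE ->.
rewrite (bigD1 (j, i)) //= !eqxx big1 ?addr0 // => -[x y] /=.
by rewrite xpair_eqE => /negbTE ->.
Qed.

End CyclicCoordinates.

(** * Coordinates on a product of cyclic groups *)

Section ProductOfCyclicGroups.
Variables (I : finType) (gT : I -> finGroupType).

Lemma cyclic_dlog (H : finGroupType) : cyclic [set: H] ->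
  exists xl : H * (H -> nat), #[xl.1]%g = #|H| /\
    forall g, (xl.2 g < #|H|)%N /\ (g = xl.1 ^+ xl.2 g)%g.
Proof.
move=> /cyclicP[x Hx].
have ox : #[x]%g = #|H| by rewrite orderE -Hx cardsT.
have /choice[l lP] g : exists m, (m < #|H|)%N /\ (g = x ^+ m)%g.
  have : g \in <[x]>%g by rewrite -Hx inE.
  by move=> /cyclePmin[m]; rewrite ox; exists m.
by exists (x, l).
Qed.

Lemma cyclic_product_coordinates (n : I -> nat) :
    (forall i, cyclic [set: gT i]) -> (forall i, #|gT i| = n i) ->
  inhabited (cyclic_coordinates {dffun forall i, gT i} n).
Proof.
move=> Gc Gn.
pose xl i := projT1 (cid (cyclic_dlog (Gc i))).
have ox i : #[(xl i).1]%g = n i.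
  by rewrite /xl; case: cid => y [/= -> _]; rewrite Gn.
have lP i g : ((xl i).2 g < n i)%N /\ (g = (xl i).1 ^+ (xl i).2 g)%g.
  by rewrite /xl; case: cid => y [/= _ yP]; rewrite -Gn.
have gt0 i : (0 < n i)%N by rewrite -ox order_gt0.
have lX i m : (xl i).2 ((xl i).1 ^+ m)%g = (m %% n i)%N.
  have [lt e] := lP i ((xl i).1 ^+ m)%g.
  by move/eqP: e; rewrite eq_expg_mod_order ox [X in _ == X]modn_small // => /eqP.
split; exists (fun i => dfung1 (xl i).1 : {dffun forall i, gT i})
    (fun i (g : {dffun forall i, gT i}) => (xl i).2 (g i)) => //.
- move=> i g h; have [_ eg] := lP i (g i); have [_ eh] := lP i (h i).
  by rewrite ffunE [in LHS]eg [in LHS]eh -expgD lX.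
- move=> i j; have [->|ij] := eqVneq i j.
    by rewrite dfung1_id -[X in (xl j).2 X]expg1 lX.
  by rewrite dfung1_dflt 1?eq_sym // -(expg0 (xl i).1) lX.
- move=> g h gh; apply/ffunP => i.
  by rewrite (lP i (g i)).2 gh -(lP i (h i)).2.
Qed.
End ProductOfCyclicGroups.

(** * Conclusion *)

Section QuotientIso.
Import GRing.Theory.
Local Open Scope ring_scope.
Local Open Scope quotient_scope.

Lemma quotzmod_iso (U V : zmodType) (S : zmodClosed U) (F : U -> V) :
    {morph F : x y / x - y} -> (forall v, exists u, F u = v) ->
    (forall u, u \in S <-> F u = 0) ->
  zmod_isomorphic (quotzmod S) V.
Proof.
move=> FB Fs FS.
pose Q := quotzmod S; pose f (q : Q) := F (generic_quotient.repr q).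
have fpi u : f (\pi_Q u) = F u.
  apply/eqP; rewrite -subr_eq0 -FB; apply/eqP/FS.
  by rewrite Quotient.idealrBE reprK.
have fB : zmod_morphism f.
  move=> x y; rewrite -[x]reprK -[y]reprK !fpi.
  by rewrite -FB -fpi; congr f; rewrite !piE.
pose fa := HB.pack_for {additive Q -> V} f
  (GRing.isZmodMorphism.Build _ _ _ fB).
exists fa.
have finj : injective f.
  move=> x y; rewrite -[x]reprK -[y]reprK !fpi => Fxy.
  by apply/eqP; rewrite -Quotient.idealrBE; apply/FS; rewrite FB Fxy subrr.
have /choice[h hP] v : exists u, F u = v by exact: Fs.
exists (fun v => \pi_Q (h v)) => [q|v] /=; last by rewrite fpi.
by apply: finj; rewrite fpi.
Qed.
End QuotientIso.

Section SecondCohomology.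
Import GRing.Theory.
Local Open Scope ring_scope.
Local Open Scope quotient_scope.

Lemma multiplesP (A : zmodType) m (x : A) :
  reflect (exists a, x = a *+ m) (x \in multiples A m).
Proof. exact: asboolP. Qed.

(** Accounts for the factors of order 1, whose generator has coordinate 0: there
    the quotient of A by its multiples is trivial. *)
Lemma mulrn1_modn (A : zmodType) m (a : A) : a *+ (1 %% m) - a \in multiples A m.
Proof.
apply/multiplesP; exists (- (a *+ (1 %/ m))).
have e : a = a *+ (1 %/ m * m) + a *+ (1 %% m) by rewrite -mulrnDr -divn_eq.
by rewrite mulNrn -mulrnA {2}e; zmod.
Qed.

Lemma quotzmod_pi0 (A : zmodType) (S : zmodClosed A) x :
  \pi_(quotzmod S) x = 0 <-> x \in S.
Proof.
rewrite -{2}(subr0 x) Quotient.idealrBE raddf0.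
by split=> /eqP.
Qed.

Variables (k : nat) (n : 'I_k -> nat) (G : finGroupType) (A : zmodType).
Variable C : cyclic_coordinates G n.
Variable P : projective_resolution (trivial_module G int).
Local Notation H1 := (dirsum (fun i : 'I_k => quotzmod (multiples A (n i)))).
Local Notation H2 := (dirsum (fun p : {p : 'I_k * 'I_k | (p.1 < p.2)%N} =>
  subzmod (zmodI (Ann A (n (val p).1)) (Ann A (n (val p).2))))).

Lemma second_cohomology_iso :
  zmod_isomorphic (group_cohomology P 2 (trivial_module G A)) (H1 * H2)%type.
Proof.
have [b] := bar_lift_exists P.
pose Z := subzmod (@cocycles _ _ P 2 (trivial_module G A)).
pose c (f : Z) := cochain_cocycle b (val f).
have cP f : cocycle2 (c f) by exact: cochain_cocycleP (valP f).
have cB f g x y : c (f - g) x y = c f x y - c g x y by [].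
have powB f g i : power_invariant C (c (f - g)) i =
    power_invariant C (c f) i - power_invariant C (c g) i.
  by rewrite -sumrB.
have comB f g i j : commutator_invariant C (c (f - g)) i j =
    commutator_invariant C (c f) i j - commutator_invariant C (c g) i j.
  by rewrite /commutator_invariant /commutator_form !cB; zmod.
have annP f i j : commutator_invariant C (c f) i j \in
    zmodI (Ann A (n i)) (Ann A (n j)).
  by rewrite !inE commutator_invariant_annl // commutator_invariant_annr // eqxx.
pose F1 f : H1 :=
  [ffun i => \pi_(quotzmod (multiples A (n i))) (power_invariant C (c f) i)].
pose F2 f : H2 := [ffun p =>
  Sub (commutator_invariant C (c f) (val p).1 (val p).2) (annP f _ _)].
apply: (quotzmod_iso (F := fun f : Z => (F1 f, F2 f))).
- move=> f g; congr pair; apply/ffunP => i; rewrite !ffunE.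
    by rewrite powB raddfB.
  by apply: val_inj; rewrite /= comB.
- case=> v1 v2.
  pose a i := generic_quotient.repr (v1 i).
  pose w2 (o : option {p : 'I_k * 'I_k | (p.1 < p.2)%N}) :=
    if o is Some p then val (v2 p) else 0.
  (* The prescribed value on pairs i < j, extended by 0 to all pairs. *)
  pose d i j := w2 (insub (i, j)).
  have dn i j : d i j *+ n i = 0 /\ d i j *+ n j = 0.
    rewrite /d; case: insubP => [p _ pE|_] /=; last by rewrite !mul0rn.
    have [-> ->] : i = (val p).1 /\ j = (val p).2 by rewrite pE.
    by have := valP (v2 p); rewrite !inE => /andP[/eqP-> /eqP->].
  have d0 i : d i i = 0 by rewrite /d insubF //= ltnn.
  have [c0 c0P [powE comE]] := invariants_surj C
    a (fun i j => (dn i j).1) (fun i j => (dn i j).2) d0.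
  have [f fP [w fE]] := cochain_cocycle_surj b c0P.
  exists (Sub f fP); congr pair; apply/ffunP => i; rewrite !ffunE.
    rewrite -[v1 i]reprK; apply/eqP; rewrite -Quotient.idealrBE.
    have -> : power_invariant C (c (Sub f fP)) i =
        power_invariant C c0 i + power_invariant C (cobound2 w) i.
      by rewrite -big_split; apply: eq_bigr => m _; rewrite /c /= fE.
    rewrite powE power_invariant_cobound addrAC.
    by apply: rpredD; [exact: mulrn1_modn|apply/multiplesP; exists (w (cc_gen C i))].
  apply: val_inj => /=; case: i => -[i j] /= ij.
  have -> : commutator_invariant C (c (Sub f fP)) i j =
      commutator_invariant C c0 i j + commutator_invariant C (cobound2 w) i j.
    by rewrite /commutator_invariant /commutator_form /c /= !fE; zmod.
  rewrite comE commutator_invariant_cobound addr0 /d [insub (j, i)]insubF ?subr0.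
    by rewrite (@insubT _ (fun p : 'I_k * 'I_k => p.1 < p.2)%N _ (i, j) ij).
  by rewrite /= ltnNge ltnW.
- move=> f; split=> [/asboolP[v fv]|[/ffunP F10 /ffunP F20]].
    pose w : G -> A := v \o bl_p b.
    have cE g h : c f g h = cobound2 w g h.
      by rewrite /c fv cochain_cocycle_codiff.
    congr pair; apply/ffunP => i; rewrite !ffunE.
      apply/quotzmod_pi0/multiplesP; exists (w (cc_gen C i)).
      by rewrite -power_invariant_cobound; apply: eq_bigr => m _; rewrite cE.
    apply: val_inj; rewrite /= -[RHS](commutator_invariant_cobound C w (val i).1 (val i).2).
    by rewrite /commutator_invariant /commutator_form !cE.
  have /choice[a aE] i : exists a, power_invariant C (c f) i = a *+ n i.
    by have := F10 i; rewrite !ffunE => /quotzmod_pi0/multiplesP.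
  have com0 i j : commutator_invariant C (c f) i j = 0.
    wlog ij : i j / (i < j)%N => [IH|].
      have [/IH//|/IH ji|/val_inj->] := ltngtP i j; last by rewrite [LHS]subrr.
      by rewrite [LHS]commutator_formC [X in - X]ji oppr0.
    by have := congr1 val (F20 (exist _ (i, j) ij)); rewrite !ffunE.
  have [w wE] := cocycle2_cobound (cP f) aE com0.
  by apply/asboolP; have [v vE] := cobound_codiff (valP f) wE; exists v.
Qed.
End SecondCohomology.

Theorem theorem4 (k : nat) (n : 'I_k -> nat) (gT : 'I_k -> finGroupType)
    (G_cyclic : forall i, cyclic [set: gT i])
    (G_order : forall i, #|gT i| = n i)
    (A : zmodType)
    (P : projective_resolution
           (trivial_module {dffun forall i : 'I_k, gT i} int)) :
  zmod_isomorphic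
    (group_cohomology P 2 (trivial_module {dffun forall i : 'I_k, gT i} A))
    (dirsum (fun i : 'I_k => quotzmod (multiples A (n i)))
     * dirsum (fun p : {p : 'I_k * 'I_k | (p.1 < p.2)%N} =>
         subzmod (zmodI (Ann A (n (val p).1)) (Ann A (n (val p).2)))))%type.
Proof.
have [C] := cyclic_product_coordinates G_cyclic G_order.
exact: second_cohomology_iso C P.
Qed.
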